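(* Let $G$ be a group, let $i\ge 0$, and let $G^{*i}=G\cup I$ with $I=\{e_1,\dots,e_i\}$ be the corresponding grouplike monoid. Let $k_1,k_2\geq i$. (1) Let $M^{(1)}=\begin{pmatrix} G^{*i} & G^{*i}\\ G^{*i} & G^{*i}\end{pmatrix}$ be a matrix of similar copies of $G^{*i}$, and let $\mathsf C^{(1)}$ be the groupoid-like category associated to this matrix. (2) Then the endomorphism sets $G^{*i}$ can be extended so as to obtain a finite category $\mathsf C^{(2)}$ associated to the matrix $M^{(2)}=\begin{pmatrix} G^{*k_1} & G^{*i}\\ G^{*i} & G^{*k_2}\end{pmatrix}$, such that for all $x\in G^{*i}$ and $y\in G^{*k_1}$ one has $x\cdot y=y\cdot x\in G^{*i}$, and the same holds for $G^{*k_2}$. (3) Suppose given the matrix $M^{(3)}=\begin{pmatrix} G^{*k_1} & L\\ R & G^{*k_2}\end{pmatrix}$, where the bimodules $L$ and $R$ are strongly $i$-unigen. Then $$M^{(1)}\subseteq M^{(2)}\subseteq M^{(3)},$$ and $M^{(3)}$ is the matrix of a unique grouplike category $\mathsf C^{(3)}$ such that $i^{max}(\mathsf C^{(3)})=i$ and such that $x\cdot y=e_i\cdot x\cdot y\cdot e_i$ for all $x\in L$, $y\in R$. Moreover $$\mathsf C^{(1)}\subseteq \mathsf C^{(2)}\subseteq \mathsf C^{(3)}.$$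
   Context: All categories considered are finite. Composition is written diagrammatically: for $f\in\mathsf C(X,Y)$ and $g\in\mathsf C(Y,Z)$ the composite is $f\cdot g\in\mathsf C(X,Z)$. A semicategory is a category without the requirement of identities. The inclusions $\mathsf C^{(1)}\subseteq\mathsf C^{(2)}\subseteq\mathsf C^{(3)}$ are inclusions of sub-semicategories (subsets of the morphism sets closed under composition, not necessarily containing the identities of the ambient category). The inclusions of matrices are entrywise. For a group $G$ with identity $e_0$ and $k\ge 0$, $G^{*k}$ is the monoid $G\sqcup\{e_1,\dots,e_k\}$ whose multiplication extends that of $G$, with $e_j g=g e_j=g$ for $g\in G$ and $e_j e_l=e_{\min(j,l)}$; its identity is the element $e_k$. For $i\le k$, $G^{*i}$ is viewed as the subset $G\cup\{e_1,\dots,e_i\}$ of $G^{*k}$. Such monoids are called grouplike, and a grouplike category is a category whose endomorphism monoids are grouplike. The groupoid-like category associated to $M^{(1)}$ has two objects, each of its four morphism sets is a copy of $G^{*i}$, and every composition is the multiplication of $G^{*i}$ (it is pulled back from the one-object category with endomorphism monoid $G^{*i}$ along the map sending both objects to the single object). An $(A,B)$-bimodule for monoids $A,B$ is a set with a left action of $A$ and a right action of $B$ that commute. The algebraic matrix of a category with objects $X,Y$ is $\begin{pmatrix}\mathsf C(X,X)&\mathsf C(X,Y)\\ \mathsf C(Y,X)&\mathsf C(Y,Y)\end{pmatrix}$, with diagonal entries regarded as monoids and off-diagonal entries as bimodules; $\mathsf C$ is associated to (is a category of) such a matrix if that is its algebraic matrix. Write $e_0,\dots,e_{k_1}$ for the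 idempotents of $G^{*k_1}$ and $f_0,\dots,f_{k_2}$ for those of $G^{*k_2}$ ($e_0,f_0$ the group identities). A $(G_1^{*k_1},G_2^{*k_2})$-bimodule $L$ is $i$-unigen if $L\cdot f_i=e_i\cdot L=:L_i$, and $L_i\simeq G_1^{*i}$ as a left module and $L_i\simeq G_2^{*i}$ as a right module. In that case there is an isomorphism $G_1\simeq G_2$ such that $L_i=G_1^{*i}$ as a $(G_1^{*k_1},G_2^{*k_2})$-bimodule. When $G_1=G_2=G$, $L$ is strongly $i$-unigen if it is $i$-unigen and this isomorphism can be taken to be the identity. The same definitions apply to $(G^{*k_2},G^{*k_1})$-bimodules $R$, with $R_i=R\cdot e_i=f_i\cdot R$. For a category $\mathsf C$ with algebraic matrix $\begin{pmatrix} G^{*k_1} & L\\ R & G^{*k_2}\end{pmatrix}$, $i^{max}(\mathsf C)$ is the maximum index $m$ such that there exist $x\in L$, $y\in R$ with $x\cdot y=e_m$ and $y\cdot x=f_m$.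
   Formalization: In (2), x·y=y·x is claimed only when the G-components of x and y commute (false otherwise). In (3), C^(3) is unique outright only if i>0 or Z(G)=1 (false otherwise); for every i it is unique among those containing C^(2) via a given inclusion M^(2)⊆M^(3). *)

(* Defs.v *)
From HB Require Import structures.
From mathcomp Require Import all_boot all_fingroup all_solvable.
From mathcomp Require Import zify.

Set Implicit Arguments.
Unset Strict Implicit.
Unset Printing Implicit Defensive.

Local Open Scope group_scope.

(** * Grouplike monoids *)

(** [grouplike G k] is G^{*k}: [inl g] is the element [g] of [G] and, indices
    being shifted by one, [inr j] is the idempotent e_{j+1} for [j < k]. *)
Definition grouplike (G : finGroupType) (k : nat) : Type := (G + 'I_k)%type.

HB.instance Definition _ (G : finGroupType) k :=
  Finite.copy (grouplike G k) (G + 'I_k)%type.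

(** e_j for j <= k, with e_0 the identity of G.  The index is truncated at k:
    [gl_e G k j] is e_k, the identity of G^{*k}, when j > k. *)
Definition gl_e (G : finGroupType) (k j : nat) : grouplike G k :=
  match k return grouplike G k with
  | 0 => inl 1
  | k'.+1 => if j is j'.+1 then inr (inord (minn j' k')) else inl 1
  end.

Section GrouplikeMonoid.
Variables (G : finGroupType) (k : nat).

Definition gl_mul (x y : grouplike G k) : grouplike G k :=
  match x, y with
  | inl g, inl h => inl (g * h)
  | inl g, inr _ => inl g
  | inr _, inl h => inl h
  | inr j, inr l => inr (if (j <= l)%N then j else l)
  end.

Lemma gl_mulA : associative gl_mul.
Proof.
move=> [g|a] [h|b] [l|c] //=; first by rewrite mulgA.
by congr inr; apply: val_inj; do !case: ifP => //=; lia.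
Qed.

Lemma gl_mul1g : left_id (gl_e G k k) gl_mul.
Proof.
rewrite /gl_e /gl_mul; clear; case: k => [|n] /=.
  by move=> [g|[]//]; rewrite mul1g.
move=> [g|j] //; congr inr; apply: val_inj; rewrite minnn /=.
by case: ifP; rewrite ?inordK //; have := ltn_ord j; lia.
Qed.

Lemma gl_mulg1 : right_id (gl_e G k k) gl_mul.
Proof.
rewrite /gl_e /gl_mul; clear; case: k => [|n] /=.
  by move=> [g|[]//]; rewrite mulg1.
move=> [g|j] //; congr inr; apply: val_inj; rewrite minnn /=.
by case: ifP; rewrite ?inordK //; have := ltn_ord j; lia.
Qed.

HB.instance Definition _ :=
  isMonoid.Build (grouplike G k) gl_mulA gl_mul1g gl_mulg1.

(** The component in [G]: g for g in G, and the unit of G for each e_j. *)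
Definition gl_part (x : grouplike G k) : G := if x is inl g then g else 1.

Lemma gl_mulE (x y : grouplike G k) : x * y = gl_mul x y.
Proof. by []. Qed.

End GrouplikeMonoid.

Lemma gl_eM (G : finGroupType) k (j l : nat) :
  gl_e G k j * gl_e G k l = gl_e G k (minn j l).
Proof.
case: k => [|k]; first by congr inl; rewrite mulg1.
case: j l => [|j] [|l]; rewrite ?minn0 ?min0n //.
  by congr inl; rewrite mulg1.
rewrite gl_mulE /= minnSS. congr inr; apply: val_inj => /=.
by case: ifP; rewrite !inordK; lia.
Qed.

Lemma gl_e1 (G : finGroupType) k : gl_e G k k = 1.
Proof. by []. Qed.

Definition gl_incl (G : finGroupType) i k (ik : (i <= k)%N)
    (x : grouplike G i) : grouplike G k :=
  match x with inl g => inl g | inr j => inr (widen_ord ik j) end.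

(** The map a |-> e_i * a from G^{*k} to G^{*i}, for i <= k. *)
Definition gl_trunc (G : finGroupType) k i (a : grouplike G k) :
    grouplike G i :=
  match a with inl g => inl g | inr j => gl_e G i j.+1 end.

Lemma gl_truncM (G : finGroupType) k i :
  {morph @gl_trunc G k i : a b / a * b}.
Proof.
move=> [g|a] [h|b]; rewrite gl_mulE /gl_trunc //.
- by case: i => [|i]; rewrite gl_mulE //=; congr inl; rewrite mulg1.
- by case: i => [|i]; rewrite gl_mulE //=; congr inl; rewrite mul1g.
rewrite gl_eM minnSS; congr gl_e; rewrite /gl_mul.
by case: ifP; lia.
Qed.

Lemma gl_trunc1 (G : finGroupType) k i :
  (i <= k)%N -> @gl_trunc G k i 1 = 1.
Proof.
rewrite -(gl_e1 G k) -(gl_e1 G i); case: k => [|k] ik.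
  by move: ik; rewrite leqn0 => /eqP ->.
case: i ik => [|i] ik //=; congr inr; apply: val_inj => /=.
by rewrite !inordK; lia.
Qed.

Lemma gl_trunc_id (G : finGroupType) k (a : grouplike G k) : gl_trunc k a = a.
Proof.
case: a => [g|j] //; case: k j => [[]//|k] j.
by congr inr; apply: val_inj; rewrite /= inordK; have := ltn_ord j; lia.
Qed.

Lemma gl_truncE (G : finGroupType) k i (ik : (i <= k)%N) (a : grouplike G k) :
  gl_incl ik (gl_trunc i a) = gl_e G k i * a.
Proof.
case: k ik a => [|k] ik [g|j] //; case: i ik => [|i] ik //=;
  try by [case: j | congr inl; rewrite mul1g].
rewrite gl_mulE /=; congr inr; apply: val_inj => /=.
by case: ifP; rewrite !inordK; have := ltn_ord j; lia.
Qed.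

(** * Bimodules over monoids *)

Record bimodule (A B : monoidType) := Bimodule {
  bimod_sort :> finType;
  actl : A -> bimod_sort -> bimod_sort;
  actr : bimod_sort -> B -> bimod_sort;
  actl1 : forall x, actl 1 x = x;
  actlM : forall a b x, actl (a * b) x = actl a (actl b x);
  actr1 : forall x, actr x 1 = x;
  actrM : forall a b x, actr x (a * b) = actr (actr x a) b;
  actA : forall a x b, actr (actl a x) b = actl a (actr x b) }.

(** G^{*i} as a (G^{*k1}, G^{*k2})-bimodule: both actions are multiplication
    in G^{*k}, of which G^{*i} is a two-sided ideal (see [gl_actlE] and
    [gl_actrE]). *)
Definition gl_bimod (G : finGroupType) (i k1 k2 : nat)
    (ik1 : (i <= k1)%N) (ik2 : (i <= k2)%N) :
  bimodule (grouplike G k1) (grouplike G k2).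
Proof.
apply: (@Bimodule (grouplike G k1) (grouplike G k2) (grouplike G i)
  (fun a x => gl_trunc i a * x) (fun x b => x * gl_trunc i b)).
- by move=> x; rewrite gl_trunc1 // mul1g.
- by move=> a b x; rewrite gl_truncM mulgA.
- by move=> x; rewrite gl_trunc1 // mulg1.
- by move=> a b x; rewrite gl_truncM mulgA.
- by move=> a x b; rewrite mulgA.
Defined.

Lemma gl_inclM (G : finGroupType) i k (ik : (i <= k)%N) :
  {morph @gl_incl G i k ik : x y / x * y}.
Proof.
by move=> [g|a] [h|b] //; rewrite !gl_mulE /=; congr inr; apply: val_inj => /=;
  case: ifP.
Qed.

Lemma gl_e_incl (G : finGroupType) i k (ik : (i <= k)%N) (x : grouplike G i) :
  gl_e G k i * gl_incl ik x = gl_incl ik x /\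
  gl_incl ik x * gl_e G k i = gl_incl ik x.
Proof.
have {1 2}-> : gl_e G k i = gl_incl ik 1.
  by rewrite -(gl_trunc1 G ik) gl_truncE mulg1.
by rewrite -!gl_inclM mul1g mulg1.
Qed.

Lemma gl_truncEr (G : finGroupType) k i (ik : (i <= k)%N) (a : grouplike G k) :
  gl_incl ik (gl_trunc i a) = a * gl_e G k i.
Proof.
rewrite gl_truncE; case: k ik a => [|k] ik [g|j]; case: i ik => [|i] ik //;
  try by [case: j | congr inl; rewrite mul1g mulg1].
rewrite !gl_mulE /=; congr inr; apply: val_inj => /=.
by do !case: ifP; rewrite !inordK; have := ltn_ord j; lia.
Qed.

Lemma gl_actlE (G : finGroupType) i k1 k2 (ik1 : (i <= k1)%N)
    (ik2 : (i <= k2)%N) (a : grouplike G k1) (x : gl_bimod G ik1 ik2) :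
  gl_incl ik1 (actl a x) = a * gl_incl ik1 x.
Proof.
by rewrite gl_inclM gl_truncEr -mulgA (proj1 (gl_e_incl ik1 x)).
Qed.

Lemma gl_actrE (G : finGroupType) i k1 k2 (ik1 : (i <= k1)%N)
    (ik2 : (i <= k2)%N) (x : gl_bimod G ik1 ik2) (b : grouplike G k2) :
  gl_incl ik2 (actr x b) = gl_incl ik2 x * b.
Proof.
by rewrite gl_inclM gl_truncE mulgA (proj2 (gl_e_incl ik2 x)).
Qed.

Section Unigen.
Variables (G1 G2 : finGroupType) (k1 k2 i : nat).
Variable L : bimodule (grouplike G1 k1) (grouplike G2 k2).

(** L_i = e_i . L *)
Definition unigen_part : {set L} := [set actl (gl_e G1 k1 i) x | x : L].

(** G1^{*i} and G2^{*i} are regarded as modules over G1^{*k1} and G2^{*k2}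
    through multiplication, as in [gl_bimod]. *)
Definition unigen : Prop :=
  [/\ [set actr x (gl_e G2 k2 i) | x : L] = unigen_part,
      exists phi : grouplike G1 i -> L,
        [/\ injective phi, phi @: setT = unigen_part
          & forall a x, phi (gl_trunc i a * x) = actl a (phi x)]
    & exists psi : grouplike G2 i -> L,
        [/\ injective psi, psi @: setT = unigen_part
          & forall x b, psi (x * gl_trunc i b) = actr (psi x) b]].

End Unigen.

(** The isomorphism between the two groups is the identity: L_i is isomorphic
    to G^{*i} as a bimodule. *)
Definition strongly_unigen (G : finGroupType) (k1 k2 i : nat)
    (L : bimodule (grouplike G k1) (grouplike G k2)) : Prop :=
  unigen i L /\
  exists phi : grouplike G i -> L,
    [/\ injective phi, phi @: setT = unigen_part i L,
        forall a x, phi (gl_trunc i a * x) = actl a (phi x)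
      & forall x b, phi (x * gl_trunc i b) = actr (phi x) b].

(** * Finite categories, with diagrammatic composition *)

Record category (Ob : finType) (hom : Ob -> Ob -> finType) := Category {
  cat_comp : forall {X Y Z}, hom X Y -> hom Y Z -> hom X Z;
  cat_id : forall X, hom X X;
  cat_compA : forall X Y Z T (f : hom X Y) (g : hom Y Z) (h : hom Z T),
    cat_comp f (cat_comp g h) = cat_comp (cat_comp f g) h;
  cat_comp1f : forall X Y (f : hom X Y), cat_comp (cat_id X) f = f;
  cat_compf1 : forall X Y (f : hom X Y), cat_comp f (cat_id Y) = f }.

(** A family of maps between morphism sets identifies [C] with a
    sub-semicategory of [D] (on the same objects): identities need not be
    preserved. *)
Definition subsemicategory (Ob : finType) (hom hom' : Ob -> Ob -> finType)
    (F : forall X Y, hom X Y -> hom' X Y)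
    (C : category hom) (D : category hom') : Prop :=
  (forall X Y, injective (F X Y)) /\
  (forall X Y Z (f : hom X Y) (g : hom Y Z),
     F X Z (cat_comp C f g) = cat_comp D (F X Y f) (F Y Z g)).

Variant obj : Type := oX | oY.

Definition bool_of_obj (o : obj) : bool := if o is oX then true else false.
Definition obj_of_bool (b : bool) : obj := if b then oX else oY.
Lemma bool_of_objK : cancel bool_of_obj obj_of_bool.
Proof. by case. Qed.
HB.instance Definition _ := Finite.copy obj (can_type bool_of_objK).

(** * Algebraic matrices of size 2 with grouplike diagonal entries *)

Record glmatrix (G : finGroupType) (k1 k2 : nat) := GLMatrix {
  mxL : bimodule (grouplike G k1) (grouplike G k2);
  mxR : bimodule (grouplike G k2) (grouplike G k1) }.

Definition mxhom (G : finGroupType) k1 k2 (M : glmatrix G k1 k2)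
    (A B : obj) : finType :=
  match A, B with
  | oX, oX => grouplike G k1
  | oX, oY => mxL M
  | oY, oX => mxR M
  | oY, oY => grouplike G k2
  end.

(** [C], whose morphism sets are the entries of [M], has algebraic matrix [M]:
    it induces on them the monoid and bimodule structures of [M]. *)
Definition has_matrix (G : finGroupType) k1 k2 (M : glmatrix G k1 k2)
    (C : category (mxhom M)) : Prop :=
  [/\ cat_id C oX = 1 :> grouplike G k1 /\
      (forall a b : grouplike G k1, @cat_comp _ _ C oX oX oX a b = a * b),
      cat_id C oY = 1 :> grouplike G k2 /\
      (forall a b : grouplike G k2, @cat_comp _ _ C oY oY oY a b = a * b),
      (forall (a : grouplike G k1) (x : mxL M),
         @cat_comp _ _ C oX oX oY a x = actl a x) /\
      (forall (x : mxL M) (b : grouplike G k2),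
         @cat_comp _ _ C oX oY oY x b = actr x b)
    & (forall (b : grouplike G k2) (y : mxR M),
         @cat_comp _ _ C oY oY oX b y = actl b y) /\
      (forall (y : mxR M) (a : grouplike G k1),
         @cat_comp _ _ C oY oX oX y a = actr y a)].

Definition mxmap (G : finGroupType) k1 k2 k1' k2'
    (M : glmatrix G k1 k2) (M' : glmatrix G k1' k2')
    (a : grouplike G k1 -> grouplike G k1') (l : mxL M -> mxL M')
    (r : mxR M -> mxR M') (b : grouplike G k2 -> grouplike G k2')
    (A B : obj) : mxhom M A B -> mxhom M' A B :=
  match A, B return mxhom M A B -> mxhom M' A B with
  | oX, oX => a
  | oX, oY => l
  | oY, oX => r
  | oY, oY => b
  end.

Definition matrix_inclusion (G : finGroupType) k1 k2 k1' k2'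
    (M : glmatrix G k1 k2) (M' : glmatrix G k1' k2')
    (a : grouplike G k1 -> grouplike G k1') (l : mxL M -> mxL M')
    (r : mxR M -> mxR M') (b : grouplike G k2 -> grouplike G k2') : Prop :=
  [/\ injective a /\ {morph a : x y / x * y},
      injective b /\ {morph b : x y / x * y},
      [/\ injective l, forall g x, l (actl g x) = actl (a g) (l x)
        & forall x h, l (actr x h) = actr (l x) (b h)]
    & [/\ injective r, forall h y, r (actl h y) = actl (b h) (r y)
        & forall y g, r (actr y g) = actr (r y) (a g)]].

(** [m] is the maximum index such that x.y = e_m and y.x = f_m for some
    x in L and y in R. *)
Definition is_imax (G : finGroupType) k1 k2 (M : glmatrix G k1 k2)
    (C : category (mxhom M)) (m : nat) : Prop :=
  let attained n :=
    [/\ (n <= k1)%N, (n <= k2)%N &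
        exists (x : mxL M) (y : mxR M),
          @cat_comp _ _ C oX oY oX x y = gl_e G k1 n /\
          @cat_comp _ _ C oY oX oY y x = gl_e G k2 n] in
  attained m /\ forall n, attained n -> (n <= m)%N.

Definition sandwiched (G : finGroupType) k1 k2 (M : glmatrix G k1 k2)
    (C : category (mxhom M)) (i : nat) : Prop :=
  forall (x : mxL M) (y : mxR M),
    let e : mxhom M oX oX := gl_e G k1 i in
    cat_comp C (x : mxhom M oX oY) (y : mxhom M oY oX) =
    cat_comp C (cat_comp C (cat_comp C e (x : mxhom M oX oY)) (y : mxhom M oY oX)) e.

(** * The matrices M1 and M2, and the category C1 *)

Definition M2 (G : finGroupType) i k1 k2 (ik1 : (i <= k1)%N)
    (ik2 : (i <= k2)%N) : glmatrix G k1 k2 :=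
  GLMatrix (gl_bimod G ik1 ik2) (gl_bimod G ik2 ik1).

Definition M1 (G : finGroupType) i : glmatrix G i i :=
  M2 G (leqnn i) (leqnn i).

(** The groupoid-like category: the pullback, along the map from two objects
    to one, of the one-object category with endomorphism monoid G^{*i}.
    [M1_val] identifies each of the four morphism sets with G^{*i}. *)
Definition M1_val (G : finGroupType) i (A B : obj) :
    mxhom (M1 G i) A B -> grouplike G i :=
  match A, B return mxhom (M1 G i) A B -> grouplike G i with
  | oX, oX => id | oX, oY => id | oY, oX => id | oY, oY => id
  end.

Definition M1_of (G : finGroupType) i (A B : obj) :
    grouplike G i -> mxhom (M1 G i) A B :=
  match A, B return grouplike G i -> mxhom (M1 G i) A B with
  | oX, oX => id | oX, oY => id | oY, oX => id | oY, oY => id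
  end.

Lemma M1_ofK (G : finGroupType) i A B : cancel (@M1_of G i A B) (@M1_val G i A B).
Proof. by case: A; case: B. Qed.

Lemma M1_valK (G : finGroupType) i A B : cancel (@M1_val G i A B) (@M1_of G i A B).
Proof. by case: A; case: B. Qed.

Definition C1 (G : finGroupType) i : category (mxhom (M1 G i)).
Proof.
apply: (@Category _ _
  (fun A B C f g => M1_of A C (M1_val f * M1_val g)) (fun A => M1_of A A 1)).
- by move=> A B C D f g h; rewrite !M1_ofK mulgA.
- by move=> A B f; rewrite M1_ofK mul1g M1_valK.
- by move=> A B f; rewrite M1_ofK mulg1 M1_valK.
Defined.

(** The inclusion of M1 in M2: G^{*i} in G^{*k} on the diagonal, the identity
    of G^{*i} elsewhere. *)
Definition M1_M2_map (G : finGroupType) i k1 k2 (ik1 : (i <= k1)%N)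
    (ik2 : (i <= k2)%N) :
  forall A B, mxhom (M1 G i) A B -> mxhom (M2 G ik1 ik2) A B :=
  mxmap (M := M1 G i) (M' := M2 G ik1 ik2)
    (gl_incl ik1) id id (gl_incl ik2).

(** The map from M2 to a matrix with entries L and R which is the identity on
    the diagonal, [phi] into L and [psi] into R. *)
Definition M2_map (G : finGroupType) i k1 k2 (ik1 : (i <= k1)%N)
    (ik2 : (i <= k2)%N) (M : glmatrix G k1 k2)
    (phi : grouplike G i -> mxL M) (psi : grouplike G i -> mxR M) :
  forall A B, mxhom (M2 G ik1 ik2) A B -> mxhom M A B :=
  mxmap (M := M2 G ik1 ik2) (M' := M) id phi psi id.
Arguments M2_map {G i k1 k2} ik1 ik2 M phi psi A B.

(* Main.v *)
(** A category with matrix (G^{*k1}, L; R, G^{*k2}) is the same thing as a pair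
    of balanced pairings L x R -> G^{*k1} and R x L -> G^{*k2} that are
    compatible with each other.  The sandwich condition makes both pairings
    factor through e_i L and R e_i, which are copies of G^{*i}, so that they
    read (x, y) |-> x c y and (y, x) |-> y c x for the element c of G^{*i} that
    pairs the two units; balancedness makes c central, and the condition on
    i^max makes it invertible.  If i > 0, the unit e_i is the only invertible
    element of G^{*i}, hence c = 1; if i = 0, c is an arbitrary element of the
    center of G, which can be absorbed into the identification of R e_i with
    G^{*i}. *)
Require Import Defs.
From HB Require Import structures.
From mathcomp Require Import all_boot all_fingroup all_solvable.
From mathcomp Require Import zify.
From Stdlib Require Import FunctionalExtensionality ProofIrrelevance.

Set Implicit Arguments.
Unset Strict Implicit.
Unset Printing Implicit Defensive.

Local Open Scope group_scope.

(** * Grouplike monoids *)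

Section Grouplike.
Variables (G : finGroupType) (i k : nat) (ik : (i <= k)%N).

Lemma gl_incl_inj : injective (@gl_incl G i k ik).
Proof.
move=> [g|a] [h|b] //= [] => [->|ab] //.
by congr inr; apply: val_inj.
Qed.

Lemma gl_incl1 : gl_incl ik 1 = gl_e G k i.
Proof. by rewrite -(gl_trunc1 G ik) gl_truncE mulg1. Qed.

Lemma gl_inclK : cancel (@gl_incl G i k ik) (@gl_trunc G k i).
Proof.
by move=> x; apply: gl_incl_inj; rewrite gl_truncE (proj1 (gl_e_incl ik x)).
Qed.

Lemma gl_trunc_e : gl_trunc i (gl_e G k i) = 1.
Proof. by rewrite -gl_incl1 gl_inclK. Qed.

Lemma gl_e_comm (a : grouplike G k) : gl_e G k i * a = a * gl_e G k i.
Proof. by rewrite -(gl_truncE ik) (gl_truncEr ik). Qed.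

Lemma gl_incl_truncl (a : grouplike G k) (w : grouplike G i) :
  gl_incl ik (gl_trunc i a * w) = a * gl_incl ik w.
Proof. by rewrite gl_inclM gl_truncEr -mulgA (proj1 (gl_e_incl ik w)). Qed.

Lemma gl_incl_truncr (w : grouplike G i) (a : grouplike G k) :
  gl_incl ik (w * gl_trunc i a) = gl_incl ik w * a.
Proof. by rewrite gl_inclM gl_truncE mulgA (proj2 (gl_e_incl ik w)). Qed.

Lemma gl_mul_trunc_comm (x : grouplike G i) (y : grouplike G k) :
  commute (gl_part x) (gl_part y) -> x * gl_trunc i y = gl_trunc i y * x.
Proof.
move=> xy; apply: gl_incl_inj; rewrite gl_incl_truncr gl_incl_truncl.
case: x y xy => [g|a] [h|b] //= xy; rewrite !gl_mulE /=.
  by congr inl.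
by congr inr; apply: val_inj; do !case: ifP => //=; lia.
Qed.

(** A group element absorbs every e_j, and each e_j is its own square. *)
Lemma gl_sqr_id (u : grouplike G k) :
  u * u * gl_e G k i = u * u -> u * gl_e G k i = u.
Proof.
case: u => [g|j]; last by rewrite !gl_mulE /= leqnn.
by move=> _; rewrite gl_mulE; case: (k) => [|k'];
  case: (i) => [|i'] //=; rewrite mulg1.
Qed.

Lemma gl_incl_e_leq (w : grouplike G i) n :
  (n <= k)%N -> gl_incl ik w = gl_e G k n -> (n <= i)%N.
Proof.
case: w => [g|j]; case: k ik => [|k'] ik'; case: n => [|n] //= nk.
move=> [/(congr1 val)]; rewrite /= inordK; last lia.
have := ltn_ord j; lia.
Qed.

End Grouplike.

(** A product with a factor in G stays in G, and e_j e_l is the smaller of the two, so for positive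
    i the only factorization of e_i is e_i e_i. *)
Lemma gl_unit1 (G : finGroupType) i (c d : grouplike G i) :
  (0 < i)%N -> c * d = 1 -> c = 1.
Proof.
rewrite -(gl_e1 G i); case: i c d => [//|i] c d _.
case: c d => [g|a] [h|b]; rewrite gl_mulE //= => -[/(congr1 val)] /= ab.
congr inr; apply: val_inj; move: ab (ltn_ord a) (ltn_ord b).
by rewrite /= inordK; last lia; case: ifP; lia.
Qed.

Lemma gl_central_unit1 (G : finGroupType) i (c d : grouplike G i) :
    (0 < i)%N \/ 'Z([set: G]) = 1 -> (forall g, c * g = g * c) -> c * d = 1 ->
  c = 1.
Proof.
case: i c d => [|i] c d H cC cd; last exact: gl_unit1 cd.
(* Here i = 0: the monoid is G itself and [c] lies in its center. *)
case: H => // Z1; case: c cC {cd} => [z|[]//] cC; congr inl; apply/set1P.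
rewrite -[[set 1]]/(1 : {set G}) -Z1; apply/centerP; split=> // g _.
by have [] := cC (inl g).
Qed.

(** * Coordinates on strongly unigen bimodules *)

Section Coordinates.
Variables (G : finGroupType) (i k1 k2 : nat).
Variables (ik1 : (i <= k1)%N) (ik2 : (i <= k2)%N).

Definition bimod_hom (L : bimodule (grouplike G k1) (grouplike G k2))
    (phi : grouplike G i -> L) : Prop :=
  (forall a x, phi (gl_trunc i a * x) = actl a (phi x)) /\
  (forall x b, phi (x * gl_trunc i b) = actr (phi x) b).

(** Here [r] is the retraction of L onto L_i, given equally by e_i on the left and f_i on the right,
    read in G^{*i} through [phi]. *)
Definition coordinates (L : bimodule (grouplike G k1) (grouplike G k2))
    (phi : grouplike G i -> L) (r : L -> grouplike G i) : Prop :=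
  [/\ cancel phi r, bimod_hom phi,
      forall x, phi (r x) = actl (gl_e G k1 i) x
    & forall x, phi (r x) = actr x (gl_e G k2 i)].

Lemma coordinates_exist (L : bimodule (grouplike G k1) (grouplike G k2))
    (phi : grouplike G i -> L) :
  strongly_unigen i L -> injective phi -> bimod_hom phi ->
  exists r, coordinates phi r.
Proof.
move=> [[LR _ _] [phi0 [phi0I im0 _ _]]] phiI phiH.
have eidem k : gl_e G k i * gl_e G k i = gl_e G k i by rewrite gl_eM minnn.
have phi_im : phi @: setT = unigen_part i L.
  (* The image of [phi] lies in L_i, and both are finite copies of G^{*i}, so they coincide. *)
  apply/eqP; rewrite eqEcard -im0 !card_imset // leqnn andbT im0.
  apply/subsetP => _ /imsetP[g _ ->]; apply/imsetP; exists (phi g) => //.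
  by rewrite -phiH.1 gl_trunc_e // mul1g.
have inim x : exists g, phi g == actl (gl_e G k1 i) x.
  have : actl (gl_e G k1 i) x \in unigen_part i L by apply: imset_f.
  by rewrite -phi_im => /imsetP[g _ ->]; exists g.
exists (fun x => xchoose (inim x)).
have phir x : phi (xchoose (inim x)) = actl (gl_e G k1 i) x.
  exact/eqP/(xchooseP (inim x)).
split=> // [g|x].
  by apply: phiI; rewrite phir -phiH.1 gl_trunc_e // mul1g.
(* The set equality e_i L = L f_i gives a pointwise one: e_i x and x f_i both equal e_i x f_i. *)
rewrite phir; have : actl (gl_e G k1 i) x \in unigen_part i L by apply: imset_f.
rewrite -{1}LR => /imsetP[y _ Ey].
have : actr x (gl_e G k2 i) \in unigen_part i L by rewrite -LR; apply: imset_f.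
move=> /imsetP[z _ Ez].
have <- : actl (gl_e G k1 i) (actr x (gl_e G k2 i)) = actr x (gl_e G k2 i).
  by rewrite Ez -actlM eidem.
by rewrite -actA Ey -actrM eidem.
Qed.

Variables (L : bimodule (grouplike G k1) (grouplike G k2)).
Variables (phi : grouplike G i -> L) (r : L -> grouplike G i).
Hypothesis C : coordinates phi r.

Lemma coord_actl a x : r (actl a x) = gl_trunc i a * r x.
Proof.
case: C => phiK [phil _] phir _; apply: (can_inj phiK).
by rewrite phil !phir -!actlM gl_e_comm.
Qed.

Lemma coord_actr x b : r (actr x b) = r x * gl_trunc i b.
Proof.
case: C => phiK [_ phil] _ phir; apply: (can_inj phiK).
by rewrite phil !phir -!actrM gl_e_comm.
Qed.

Lemma coord_homE g : phi g = actl (gl_incl ik1 g) (phi 1).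
Proof. by case: C => _ [<- _] _ _; rewrite gl_inclK mulg1. Qed.

Lemma coord_homEr g : phi g = actr (phi 1) (gl_incl ik2 g).
Proof. by case: C => _ [_ <-] _ _; rewrite gl_inclK mul1g. Qed.

(** An element of G^{*i} absorbs e_i, so it acts on [x] only through e_i x. *)
Lemma actl_incl g x : actl (gl_incl ik1 g) x = phi (g * r x).
Proof.
case: C => _ [phil _] phir _; rewrite -{2}(gl_inclK ik1 g) phil phir -actlM.
by rewrite (proj2 (gl_e_incl ik1 g)).
Qed.

Lemma actr_incl g x : actr x (gl_incl ik2 g) = phi (r x * g).
Proof.
case: C => _ [_ phil] _ phir; rewrite -{2}(gl_inclK ik2 g) phil phir -actrM.
by rewrite (proj1 (gl_e_incl ik2 g)).
Qed.

End Coordinates.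

Lemma gl_bimod_coordinates (G : finGroupType) i k1 k2
    (ik1 : (i <= k1)%N) (ik2 : (i <= k2)%N) :
  @coordinates G i k1 k2 (gl_bimod G ik1 ik2) id id.
Proof. by split=> // x /=; rewrite gl_trunc_e ?mul1g ?mulg1. Qed.

(** * Pairings of bimodules *)

Section Pairings.
Variables (A B : monoidType) (L : bimodule A B) (R : bimodule B A).

(** Equivalently, a bimodule map from the tensor product of L and R over B to A. *)
Definition balanced (m : L -> R -> A) : Prop :=
  [/\ forall a x y, m (actl a x) y = a * m x y,
      forall x y a, m x (actr y a) = m x y * a
    & forall x b y, m (actr x b) y = m x (actl b y)].

Definition compatible (m : L -> R -> A) (n : R -> L -> B) : Prop :=
  forall x y z, actl (m x y) z = actr x (n y z).

End Pairings.

(** A Morita context. Of the sixteen associativity laws of a two-object category, these are the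
    eight in which the path changes object at least twice; the others are monoid and bimodule
    laws. *)
Definition morita (A B : monoidType) (L : bimodule A B) (R : bimodule B A)
    (m : L -> R -> A) (n : R -> L -> B) : Prop :=
  [/\ balanced m, balanced n, compatible m n & compatible n m].

(** * Categories as pairings *)

Section MatrixCategories.
Variables (G : finGroupType) (k1 k2 : nat) (M : glmatrix G k1 k2).
Implicit Types C D : category (mxhom M).

Definition pairLR C : mxL M -> mxR M -> grouplike G k1 :=
  @cat_comp _ _ C oX oY oX.

Definition pairRL C : mxR M -> mxL M -> grouplike G k2 :=
  @cat_comp _ _ C oY oX oY.

Lemma has_matrix_morita C : has_matrix C -> morita (pairLR C) (pairRL C).
Proof.
move=> [[_ mX] [_ mY] [Ll Lr] [Rl Rr]]; rewrite /pairLR /pairRL.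
have A := @cat_compA _ _ C.
split; first split=> *.
- by rewrite -mX -Ll (A oX oX oY oX).
- by rewrite -mX -Rr (A oX oY oX oX).
- by rewrite -Lr -Rl (A oX oY oY oX).
- split=> *.
  + by rewrite -mY -Rl (A oY oY oX oY).
  + by rewrite -mY -Lr (A oY oX oY oY).
  + by rewrite -Rr -Ll (A oY oX oX oY).
- by move=> *; rewrite -Ll -Lr (A oX oY oX oY).
- by move=> *; rewrite -Rl -Rr (A oY oX oY oX).
Qed.

Section OfPairings.
Variables (m : mxL M -> mxR M -> grouplike G k1).
Variables (n : mxR M -> mxL M -> grouplike G k2).

Definition pairing_comp (X Y Z : obj) :
    mxhom M X Y -> mxhom M Y Z -> mxhom M X Z :=
  match X, Y, Z return mxhom M X Y -> mxhom M Y Z -> mxhom M X Z with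
  | oX, oX, oX => fun a b : grouplike G k1 => a * b
  | oX, oX, oY => @actl _ _ _
  | oX, oY, oX => m
  | oX, oY, oY => @actr _ _ _
  | oY, oX, oX => @actr _ _ _
  | oY, oX, oY => n
  | oY, oY, oX => @actl _ _ _
  | oY, oY, oY => fun a b : grouplike G k2 => a * b
  end.

Definition pairing_id (X : obj) : mxhom M X X :=
  match X return mxhom M X X with
  | oX => (1 : grouplike G k1) | oY => (1 : grouplike G k2)
  end.

Lemma morita_category : morita m n ->
  exists C, [/\ has_matrix C, pairLR C = m & pairRL C = n].
Proof.
move=> [[m1 m2 m3] [n1 n2 n3] mn nm].
have compA X Y Z T f g h : @pairing_comp X Y T f (@pairing_comp Y Z T g h) =
    @pairing_comp X Z T (@pairing_comp X Y Z f g) h.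
  by case: X Y Z T f g h => [] [] [] [] f g h //=;
    rewrite ?mulgA ?actlM ?actrM ?actA ?m1 ?m2 ?m3 ?n1 ?n2 ?n3 ?mn ?nm.
have comp1 X Y f : @pairing_comp X X Y (pairing_id X) f = f.
  by case: X Y f => [] [] f /=; rewrite ?mul1g ?actl1.
have compr1 X Y f : @pairing_comp X Y Y f (pairing_id Y) = f.
  by case: X Y f => [] [] f /=; rewrite ?mulg1 ?actr1.
by exists (Category compA comp1 compr1).
Qed.

End OfPairings.

(** The matrix fixes the identities and six of the eight compositions; only the two pairings are
    free. *)
Lemma category_eq C D : has_matrix C -> has_matrix D ->
  (forall x y, pairLR C x y = pairLR D x y) ->
  (forall y x, pairRL C y x = pairRL D y x) -> C = D.
Proof.
move=> [[iX mX] [iY mY] [Ll Lr] [Rl Rr]] [[iX' mX'] [iY' mY'] [Ll' Lr'] [Rl' Rr']].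
rewrite /pairLR /pairRL.
case: C iX mX iY mY Ll Lr Rl Rr => c e cA c1 c1' /=.
move=> iX mX iY mY Ll Lr Rl Rr.
case: D iX' mX' iY' mY' Ll' Lr' Rl' Rr' => c' e' cA' d1 d1' /=.
move=> iX' mX' iY' mY' Ll' Lr' Rl' Rr' LR RL.
have Ee : e = e'.
  by apply: functional_extensionality_dep => -[]; rewrite ?iX ?iX' ?iY ?iY'.
have Ec : c = c'.
  apply: functional_extensionality_dep => X.
  apply: functional_extensionality_dep => Y.
  apply: functional_extensionality_dep => Z.
  apply: functional_extensionality => f; apply: functional_extensionality => g.
  case: X Y Z f g => [] [] [] f g.
  - by rewrite mX mX'.
  - by rewrite Ll Ll'.
  - exact: LR.
  - by rewrite Lr Lr'.
  - by rewrite Rr Rr'.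
  - exact: RL.
  - by rewrite Rl Rl'.
  - by rewrite mY mY'.
by subst c' e'; congr Category; apply: proof_irrelevance.
Qed.

End MatrixCategories.

Lemma inclusion_subsemicategory (G : finGroupType) k1 k2 k1' k2'
    (M : glmatrix G k1 k2) (M' : glmatrix G k1' k2')
    (a : grouplike G k1 -> grouplike G k1') (l : mxL M -> mxL M')
    (r : mxR M -> mxR M') (b : grouplike G k2 -> grouplike G k2')
    (C : category (mxhom M)) (D : category (mxhom M')) :
  matrix_inclusion a l r b -> has_matrix C -> has_matrix D ->
  (forall x y, a (pairLR C x y) = pairLR D (l x) (r y)) ->
  (forall y x, b (pairRL C y x) = pairRL D (r y) (l x)) ->
  subsemicategory (mxmap a l r b) C D.
Proof.
move=> [[aI aM] [bI bM] [lI ll lr] [rI rl rr]].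
move=> [[_ mX] [_ mY] [Ll Lr] [Rl Rr]] [[_ mX'] [_ mY'] [Ll' Lr'] [Rl' Rr']] LR RL.
split; first by move=> [] [].
move=> [] [] [] f g /=.
- by rewrite mX mX' aM.
- by rewrite Ll Ll' ll.
- exact: LR.
- by rewrite Lr Lr' lr.
- by rewrite Rr Rr' rr.
- exact: RL.
- by rewrite Rl Rl' rl.
- by rewrite mY mY' bM.
Qed.

(** * Sandwiched pairings *)

Section Sandwich.
Variables (G : finGroupType) (i k1 k2 : nat).
Variables (ik1 : (i <= k1)%N) (ik2 : (i <= k2)%N).
Variables (L : bimodule (grouplike G k1) (grouplike G k2)).
Variables (R : bimodule (grouplike G k2) (grouplike G k1)).
Variables (phi : grouplike G i -> L) (r : L -> grouplike G i).
Variables (psi : grouplike G i -> R) (s : R -> grouplike G i).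
Hypotheses (phiC : coordinates phi r) (psiC : coordinates psi s).

Lemma coord_morita :
  morita (fun x y => gl_incl ik1 (r x * s y))
         (fun y x => gl_incl ik2 (s y * r x)).
Proof.
have lr := coord_actl ik1 phiC; have rr := coord_actr ik2 phiC.
have ls := coord_actl ik2 psiC; have rs := coord_actr ik1 psiC.
split; first split=> *.
- by rewrite lr -mulgA gl_incl_truncl.
- by rewrite rs mulgA gl_incl_truncr.
- by rewrite rr ls mulgA.
- split=> *.
  + by rewrite ls -mulgA gl_incl_truncl.
  + by rewrite rr mulgA gl_incl_truncr.
  + by rewrite rs lr mulgA.
- by move=> *; rewrite (actl_incl ik1 phiC) (actr_incl ik2 phiC) mulgA.
- by move=> *; rewrite (actl_incl ik2 psiC) (actr_incl ik1 psiC) mulgA.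
Qed.

Lemma sandwiched_pairings (m : L -> R -> grouplike G k1)
    (n : R -> L -> grouplike G k2) :
    morita m n ->
    (forall x y, m x y = m (actl (gl_e G k1 i) x) y * gl_e G k1 i) ->
  exists2 c : grouplike G i, forall g, c * g = g * c
    & (forall x y, m x y = gl_incl ik1 (r x * c * s y)) /\
      (forall y x, n y x = gl_incl ik2 (s y * c * r x)).
Proof.
move=> [[m1 m2 m3] [n1 n2 n3] mn nm] ms.
have [phiK phiH phil phir] := phiC; have [psiK psiH psil psir] := psiC.
have mT x y : m x y = gl_incl ik1 (gl_trunc i (m x y)).
  by rewrite gl_truncEr {2}ms -mulgA gl_eM minnn -ms.
(* The square of u = n y x is n y ((m x y) x), where m x y lies in G^{*i}, so
   u * u lies in G^{*i}, and therefore so does u. *)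
have nT y x : n y x = gl_incl ik2 (gl_trunc i (n y x)).
  rewrite gl_truncEr; symmetry; apply: gl_sqr_id.
  rewrite -n2 -mn mT (actl_incl ik1 phiC) -n2.
  by rewrite -phiH.2 gl_trunc_e // mulg1.
(* Both pairings take values fixed by e_i or f_i, so these idempotents can be moved onto the
   arguments. *)
have mE x y : m x y = m (phi (r x)) (psi (s y)).
  by rewrite phil psir m1 m2 [in LHS]ms m1 !mulgA.
have nE y x : n y x = n (psi (s y)) (phi (r x)).
  by rewrite psil phir n1 n2 nT (proj2 (gl_e_incl ik2 _)) (proj1 (gl_e_incl ik2 _)).
pose c := gl_trunc i (m (phi 1) (psi 1)).
pose d := gl_trunc i (n (psi 1) (phi 1)).
have mc g h : m (phi g) (psi h) = gl_incl ik1 (g * c * h).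
  rewrite (coord_homE ik1 phiC g) (coord_homEr ik1 psiC h) m1 m2.
  by rewrite !gl_inclM -mT mulgA.
have nd g h : n (psi g) (phi h) = gl_incl ik2 (g * d * h).
  rewrite (coord_homE ik2 psiC g) (coord_homEr ik2 phiC h) n1 n2.
  by rewrite !gl_inclM -nT mulgA.
(* Slide [g] across the pairing of the two units by balancedness. *)
have cC g : c * g = g * c.
  apply: (@gl_incl_inj _ _ _ ik1); rewrite -[g * c]mulg1 -mc.
  rewrite (coord_homEr ik2 phiC g) m3 -(coord_homE ik2 psiC g) mc.
  by rewrite mul1g.
(* Compatibility on the triple of units. *)
have cd : c = d.
  have := mn (phi 1) (psi 1) (phi 1); rewrite mc nd (actl_incl ik1 phiC).
  rewrite (actr_incl ik2 phiC) => /(can_inj phiK).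
  by rewrite phiK !mul1g !mulg1.
exists c => //; split=> [x y | y x]; first by rewrite mE mc.
by rewrite nE nd -cd.
Qed.

End Sandwich.

(** * Categories over strongly unigen bimodules *)

Section StronglyUnigenCategories.
Variables (G : finGroupType) (i k1 k2 : nat).
Variables (ik1 : (i <= k1)%N) (ik2 : (i <= k2)%N).
Variable M : glmatrix G k1 k2.
Implicit Types C D : category (mxhom M).

(** The normalization c = 1 with respect to given coordinates. *)
Definition standard (r : mxL M -> grouplike G i) (s : mxR M -> grouplike G i) C :
    Prop :=
  [/\ has_matrix C, forall x y, pairLR C x y = gl_incl ik1 (r x * s y)
    & forall y x, pairRL C y x = gl_incl ik2 (s y * r x)].

Lemma standard_unique r s C D : standard r s C -> standard r s D -> C = D.
Proof.
move=> [CM CLR CRL] [DM DLR DRL]; apply: category_eq => // x y.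
  by rewrite CLR DLR.
by rewrite CRL DRL.
Qed.

Section Coord.
Variables (phi : grouplike G i -> mxL M) (r : mxL M -> grouplike G i).
Variables (psi : grouplike G i -> mxR M) (s : mxR M -> grouplike G i).
Hypotheses (phiC : coordinates phi r) (psiC : coordinates psi s).

Lemma standard_exists : exists C, standard r s C.
Proof.
have [C [CM CLR CRL]] := morita_category (coord_morita ik1 ik2 phiC psiC).
by exists C; split=> //; rewrite ?CLR ?CRL.
Qed.

(** The two units attain e_i and f_i; all values of the pairing on L x R lie in G^{*i}, which
    contains no e_n with n > i. *)
Lemma standard_admissible C : standard r s C ->
  [/\ has_matrix C, is_imax C i & sandwiched C i].
Proof.
have [phiK _ _ _] := phiC; have [psiK _ _ _] := psiC.
move=> [CM CLR CRL]; split=> //; first split.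
- split=> //; exists (phi 1), (psi 1); rewrite -/(pairLR C _ _) -/(pairRL C _ _).
  by rewrite CLR CRL phiK psiK mulg1 !gl_incl1.
- move=> n [nk1 _ [x [y []]]]; rewrite -/(pairLR C _ _) CLR => E _.
  exact: gl_incl_e_leq E.
case: CM => [[_ mX] _ [Ll _] _] x y /=.
rewrite Ll mX -/(pairLR C _ _) -/(pairLR C _ _) !CLR (coord_actl ik1 phiC).
by rewrite gl_trunc_e // mul1g (proj2 (gl_e_incl ik1 _)).
Qed.

Lemma admissible_pairings C :
    has_matrix C -> is_imax C i -> sandwiched C i ->
  exists c d : grouplike G i,
    [/\ forall g, c * g = g * c, forall g, d * g = g * d, c * d = 1,
        forall x y, pairLR C x y = gl_incl ik1 (r x * c * s y)
      & forall y x, pairRL C y x = gl_incl ik2 (s y * c * r x)].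
Proof.
move=> CM [[_ _ [x0 [y0 [E _]]]] _] CS.
have [|c cC [CLR CRL]] :=
    sandwiched_pairings ik1 ik2 phiC psiC (has_matrix_morita CM).
  case: CM => [[_ mX] _ [Ll _] _] x y.
  by rewrite -mX -Ll; apply: CS.
(* The pair attaining e_i provides the inverse of [c]. *)
have cd : c * (r x0 * s y0) = 1.
  apply: (@gl_incl_inj _ _ _ ik1); rewrite gl_incl1 -E -/(pairLR C _ _) CLR.
  by rewrite mulgA cC.
exists c, (r x0 * s y0); split=> // g; move: (r x0 * s y0) cd => d cd.
have dc : d * c = 1 by rewrite -cC.
(* The inverse of a central element is central. *)
by rewrite -[LHS]mulg1 -cd mulgA -(mulgA d g) -(cC g) (mulgA d) dc mul1g.
Qed.

End Coord.

End StronglyUnigenCategories.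

(** * The three nested categories and the uniqueness of the largest *)

Theorem theorem1p4 (G : finGroupType) (i k1 k2 : nat)
    (ik1 : (i <= k1)%N) (ik2 : (i <= k2)%N) :
  has_matrix (C1 G i) /\
  exists C2 : category (mxhom (M2 G ik1 ik2)),
    [/\ has_matrix C2,
        subsemicategory (M1_M2_map ik1 ik2) (C1 G i) C2,
        (* x.y and y.x, computed in G^{*k1}, are in G^{*i}, and are equal as
           soon as the components of x and y in G commute *)
        forall (x : grouplike G i) (y : grouplike G k1),
          let yx : grouplike G i := @cat_comp _ _ C2 oX oX oY y x in
          let xy : grouplike G i := @cat_comp _ _ C2 oY oX oX x y in
          [/\ gl_incl ik1 yx = y * gl_incl ik1 x,
              gl_incl ik1 xy = gl_incl ik1 x * y
            & commute (gl_part x) (gl_part y) -> xy = yx]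
      & forall (x : grouplike G i) (y : grouplike G k2),
          let yx : grouplike G i := @cat_comp _ _ C2 oY oY oX y x in
          let xy : grouplike G i := @cat_comp _ _ C2 oX oY oY x y in
          [/\ gl_incl ik2 yx = y * gl_incl ik2 x,
              gl_incl ik2 xy = gl_incl ik2 x * y
            & commute (gl_part x) (gl_part y) -> xy = yx]]
  /\
  forall (L : bimodule (grouplike G k1) (grouplike G k2))
         (R : bimodule (grouplike G k2) (grouplike G k1)),
    strongly_unigen i L -> strongly_unigen i R ->
    let M3 := GLMatrix L R in
    let included phi psi :=
      matrix_inclusion (M := M2 G ik1 ik2) (M' := M3) id phi psi id in
    let admissible (C : category (mxhom M3)) :=
      [/\ has_matrix C, is_imax C i & sandwiched C i] in
    [/\ (* M1 is included in M2, and M2 in M3 *)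
        matrix_inclusion (M := M1 G i) (M' := M2 G ik1 ik2)
          (gl_incl ik1) id id (gl_incl ik2),
        exists phi psi, included phi psi,
        (* for each inclusion of M2 in M3, there is exactly one C3 that
           contains C2 through it *)
        forall phi psi, included phi psi ->
          exists! C3 : category (mxhom M3),
            admissible C3 /\
            subsemicategory (M2_map ik1 ik2 M3 phi psi) C2 C3,
        (* every C3 contains C2 through some inclusion of M2 in M3 *)
        forall C3 : category (mxhom M3), admissible C3 ->
          exists phi psi, included phi psi /\
            subsemicategory (M2_map ik1 ik2 M3 phi psi) C2 C3
      & (* C3 is unique without reference to C2, unless i = 0 and the center
           of G is not trivial *)
        (0 < i)%N \/ 'Z([set: G]) = 1 ->
          exists! C3 : category (mxhom M3), admissible C3].
Proof.
have M12 : matrix_inclusion (M := M1 G i) (M' := M2 G ik1 ik2)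
    (gl_incl ik1) id id (gl_incl ik2).
  by split; split=> //=; try exact: gl_incl_inj; try exact: gl_inclM;
    move=> *; rewrite gl_inclK gl_trunc_id.
have C1M : has_matrix (C1 G i).
  by split; split=> //= *; rewrite gl_trunc_id.
split=> //.
(* [C2] is the standard category for the identity coordinates of G^{*i}. *)
have [C2 C2S] := @standard_exists _ _ _ _ ik1 ik2 (M2 G ik1 ik2) _ _ _ _
  (gl_bimod_coordinates G ik1 ik2) (gl_bimod_coordinates G ik2 ik1).
have [C2M C2LR C2RL] := C2S.
exists C2; split.
  have [_ _ [Ll Lr] [Rl Rr]] := C2M.
  split=> //.
  - by apply: inclusion_subsemicategory => // x y; rewrite ?C2LR ?C2RL.
  - move=> x y /=; rewrite Ll Rr /=.
    by split; rewrite ?gl_incl_truncl ?gl_incl_truncr //;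
      apply: gl_mul_trunc_comm.
  - move=> x y /=; rewrite Rl Lr /=.
    by split; rewrite ?gl_incl_truncl ?gl_incl_truncr //;
      apply: gl_mul_trunc_comm.
move=> L R Ls Rs M3 included admissible.
have incl_hom phi psi : included phi psi <->
    [/\ injective phi, bimod_hom (phi : _ -> L), injective psi
      & bimod_hom (psi : _ -> R)].
  split=> [[_ _ [? ? ?] [? ? ?]] | [? [? ?] ? [? ?]]]; first by split.
  by rewrite /included; split; split.
have sub_standard phi psi (C3 : category (mxhom M3)) r s :
    included phi psi -> coordinates phi r -> coordinates psi s ->
    standard ik1 ik2 r s C3 ->
    subsemicategory (M2_map ik1 ik2 M3 phi psi) C2 C3.
  move=> inc [phiK _ _ _] [psiK _ _ _] [C3M C3LR C3RL].
  by apply: inclusion_subsemicategory => // x y;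
    rewrite ?C2LR ?C2RL ?C3LR ?C3RL phiK psiK.
have [phi0 [phi0I _ phi0l phi0r]] := Ls.2.
have [psi0 [psi0I _ psi0l psi0r]] := Rs.2.
have [r0 phi0C] := coordinates_exist ik1 Ls phi0I (conj phi0l phi0r).
have [s0 psi0C] := coordinates_exist ik2 Rs psi0I (conj psi0l psi0r).
split=> //.
- by exists phi0, psi0; apply/incl_hom.
- move=> phi psi inc; have /incl_hom[phiI phiH psiI psiH] := inc.
  have [r phiC] := coordinates_exist ik1 Ls phiI phiH.
  have [s psiC] := coordinates_exist ik2 Rs psiI psiH.
  have [C3 C3S] := standard_exists ik1 ik2 phiC psiC (M := M3).
  exists C3; split; first split.
  + exact: (standard_admissible (M := M3) phiC psiC C3S).
  + exact: sub_standard C3S.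
  move=> D [[DM Di Ds] [_ DF]]; apply: (standard_unique C3S).
  have [c [d [_ _ _ DLR DRL]]] :=
    admissible_pairings ik1 ik2 (M := M3) phiC psiC DM Di Ds.
  suff c1 : c = 1 by split=> // *; rewrite ?DLR ?DRL c1 mulg1.
  (* In [C2] the two units compose to e_i, and in [D] their images compose to [c]. *)
  have := DF oX oY oX (1 : grouplike G i) (1 : grouplike G i).
  rewrite /= -/(pairLR C2 _ _) -/(pairLR D _ _) C2LR DLR => /gl_incl_inj.
  by have [-> _ _ _] := phiC; have [-> _ _ _] := psiC; rewrite !mulg1 mul1g.
- move=> C3 [C3M C3i C3s].
  have [c [d [cC dC cd C3LR C3RL]]] :=
    admissible_pairings ik1 ik2 (M := M3) phi0C psi0C C3M C3i C3s.
  (* Rescaling psi0 by the inverse of c normalizes the pairings. *)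
  pose psi x := psi0 (d * x); exists phi0, psi.
  have inc : included phi0 psi.
    apply/incl_hom; split=> // [x y /psi0I E|].
      by rewrite -[x]mul1g -[y]mul1g -cd -!mulgA E.
    (* Left multiplication by [d] respects the right action by associativity and the left action
       because [d] is central. *)
    split=> [a x|x b]; rewrite /psi; last by rewrite mulgA psi0r.
    by rewrite mulgA (dC (gl_trunc i a)) -mulgA psi0l.
  have [phiK _ _ _] := phi0C; have [psiK _ _ _] := psi0C.
  split=> //; apply: inclusion_subsemicategory => // [x y|y x].
    by rewrite C2LR C3LR phiK psiK -mulgA (mulgA c) cd mul1g.
  by rewrite C2RL C3RL phiK psiK dC -(mulgA y) -(cC d) cd mulg1.
move=> H; have [C3 C3S] := standard_exists ik1 ik2 phi0C psi0C (M := M3).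
exists C3; split; first exact: (standard_admissible (M := M3) phi0C psi0C C3S).
move=> D [DM Di Ds]; apply: (standard_unique C3S).
have [c [d [cC _ cd DLR DRL]]] :=
    admissible_pairings ik1 ik2 (M := M3) phi0C psi0C DM Di Ds.
(* Now c = 1 in any coordinates, so no inclusion of [C2] is needed to normalize. *)
have c1 := gl_central_unit1 H cC cd.
by split=> // *; rewrite ?DLR ?DRL c1 mulg1.
Qed.
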